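(* Let $T\subseteq S$. For each $k\ge1$ consider the following permutations of length $k$ in one-line notation: $\mathrm{id}_k=1\,2\cdots k$; $u_k=k\,2\,3\cdots(k-1)\,1$; $v_k=k\,1\,2\cdots(k-1)$; $w_k=2\,3\cdots k\,1$; $x_k=2\,1\,3\cdots k$; $y_k=1\,2\cdots(k-2)\,k\,(k-1)$; and, for $2\le r\le k$, the adjacent transposition $t_{k,r}=(r-1,\;r)\in S_k$. If at least one of the following holds: (a) $T\cap\{u_k,v_k,w_k,\mathrm{id}_k : k\ge1\}=\emptyset$; (b) $T\cap\{\mathrm{id}_k,\ t_{k,r} : 2\le r\le k,\ k\ge1\}=\emptyset$; (c) $T\cap\{w_k,\mathrm{id}_k,x_k : k\ge1\}=\emptyset$; (d) $T\cap\{y_k,\mathrm{id}_k,w_k : k\ge1\}=\emptyset$; then $\langle S_n(T)\rangle=S_n$ for every $n$. In particular: (i) if $T\subseteq S_3$ and $\langle S_n(T)\rangle\ne S_n$, then $T$ shares at least one element with each of the sets $\{123,231,312,321\}$, $\{123,132,213\}$, $\{123,213,231\}$ and $\{123,132,231\}$; (ii) if $T\subseteq S_4$ and $\langle S_n(T)\rangle\neq S_n$, then $T$ shares at least one element with each of the sets $\{1234,2341,4123,4231\}$, $\{1234,1243,1324,2134\}$, $\{1234,2134,2341\}$ and $\{1234,1243,2341\}$.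
   Context: $S_n$ is the symmetric group on $[n]$, permutations written in one-line notation or in cycle notation (with parentheses), $S=\bigcup_{n\ge0}S_n$. A permutation $\pi\in S_n$ contains the pattern $\tau\in S_k$ if some subsequence of $\pi$ of length $k$ is order-isomorphic to $\tau$; otherwise it avoids $\tau$. For $T\subseteq S$, $S_n(T)$ is the set of permutations in $S_n$ avoiding every pattern in $T$, and $\langle S_n(T)\rangle$ is the subgroup of $S_n$ it generates.
   Formalization: In the general statement T is assumed not to contain the empty permutation (of length 0): if it did, every S_n(T) would be empty and the claim would fail for n ≥ 2, e.g. for T = S_0. Parts (i) and (ii) are unchanged. *)

(* Defs.v *)
From mathcomp Require Import all_boot all_fingroup.
From mathcomp Require Import boolp classical_sets.

Set Implicit Arguments.
Unset Strict Implicit.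
Unset Printing Implicit Defensive.

Local Open Scope classical_set_scope.

(* S, the disjoint union of all S_n with n >= 0 *)
Definition perms : Type := {n : nat & 'S_n}.

Definition Sym_of_length (n : nat) : set perms := [set p | tag p = n].

(* tau occurs in pi as a pattern: the positions are given by the strictly
   increasing map f. *)
Definition contains (n k : nat) (pi : 'S_n) (tau : 'S_k) : Prop :=
  exists f : 'I_k -> 'I_n,
    {homo f : i j / (i < j)%N} /\
    forall i j : 'I_k, (pi (f i) < pi (f j))%N = (tau i < tau j)%N.

(* S_n(T), as a finite set so that it generates a subgroup << . >> of 'S_n *)
Definition avoiders (n : nat) (T : set perms) : {set 'S_n} :=
  finset (fun pi : 'S_n =>
    `[< forall tau : perms, T tau -> ~ contains pi (tagged tau) >]).

(* 'S_n acts on {0, ..., n-1}, one-line notation uses the letters 1, ..., n. *)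
Definition one_line (n : nat) (p : 'S_n) : seq nat :=
  [seq (p i).+1 | i <- enum 'I_n].

Definition of_one_line (s : seq (seq nat)) : set perms :=
  [set p | one_line (tagged p) \in s].

(* The formulas for u_k, x_k and y_k make sense for k >= 2 only; all words of
   length 1 are taken to be that of the identity. *)
Definition id_word (k : nat) : seq nat := iota 1 k.
Definition u_word (k : nat) : seq nat :=
  if k <= 1 then id_word k else k :: iota 2 (k - 2) ++ [:: 1].
Definition v_word (k : nat) : seq nat :=
  if k <= 1 then id_word k else k :: iota 1 (k - 1).
Definition w_word (k : nat) : seq nat :=
  if k <= 1 then id_word k else iota 2 (k - 1) ++ [:: 1].
Definition x_word (k : nat) : seq nat :=
  if k <= 1 then id_word k else [:: 2; 1] ++ iota 3 (k - 2).
Definition y_word (k : nat) : seq nat :=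
  if k <= 1 then id_word k else iota 1 (k - 2) ++ [:: k; k - 1].

(* The singleton of the adjacent transposition (r-1, r) of S_k if 2 <= r <= k;
   the letter l of [k] is the ordinal of value l - 1. *)
Definition adj_transp (k r : nat) : set perms :=
  [set p | exists i j : 'I_k,
     [/\ i.+1 = r.-1, j.+1 = r & p = Tagged (fun n => 'S_n) (tperm i j)]].

(* Main.v *)
(** In one-line notation the n-cycle i |-> i + 1 reads 2 3 ... n 1, the
    transposition of the two extremal letters reads n 2 ... (n-1) 1, and the
    patterns of a permutation are found by deleting letters and standardizing:
    the patterns of the cycle are the w_k and id_k, those of the extremal
    transposition are the u_k, v_k, w_k and id_k (according to which of the two
    extremal letters are kept), and those of an adjacent transposition are the id_k
    and t_{k,r} (with r = 2, resp. r = k, when it moves the first, resp. last,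
    two letters). Each hypothesis thus puts a generating set of S_n into S_n(T):
    the cycle and the extremal transposition for (a), all adjacent
    transpositions for (b), the cycle and the first, resp. last, adjacent
    transposition for (c), resp. (d). *)
Require Import Defs.
From mathcomp Require Import all_boot all_fingroup.
From mathcomp Require Import ssralg zmodp zify.
From mathcomp Require Import boolp classical_sets.

Set Implicit Arguments.
Unset Strict Implicit.
Unset Printing Implicit Defensive.

Ltac if_lia := repeat case: ifP => ?; lia.

(** * Permutations recovered from the relative order of their values *)

Lemma card_ord_preim_ltn (k m : nat) (g : 'I_k -> 'I_k) :
  injective g -> m <= k -> #|[set j | g j < m]%SET| = m.
Proof.
move=> injg lemk.
have -> : [set j | g j < m]%SET = g @^-1: [set i : 'I_k | i < m]%SET.
  by apply/finset.setP => j; rewrite !inE.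
rewrite card_preimset // -[RHS](card_ord m).
have injw : injective (widen_ord lemk).
  by move=> x y /(congr1 val) /= e; apply: val_inj.
rewrite -cardsT -(card_imset _ injw); congr #|pred_of_set _|.
apply/finset.setP => i; rewrite inE; apply/idP/imsetP => [ltim | [j _ ->] //=].
by exists (Ordinal ltim); rewrite ?inE //; apply: val_inj.
Qed.

(** Both [tau] and [g] are injective with values below [k], so each value is the number of arguments
    with a smaller value, and this number depends on the relative order only. A pattern is thus
    identified by exhibiting any function with the same comparisons. *)
Lemma perm_order_eq (k : nat) (tau : 'S_k) (g : 'I_k -> nat) :
  (forall i : 'I_k, g i < k) ->
  (forall i j : 'I_k, (tau i < tau j) = (g i < g j)) ->
  forall i, tau i = g i :> nat.
Proof.
move=> gk ord_g i; pose h (j : 'I_k) : 'I_k := Ordinal (gk j).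
have injh : injective h.
  move=> a b /(congr1 val) /= eqg; apply: (@perm_inj _ tau); apply: val_inj => /=.
  have := ord_g a b; have := ord_g b a; rewrite eqg ltnn; lia.
rewrite -(@card_ord_preim_ltn k (tau i) tau) ?(ltnW (ltn_ord _)) //; last exact: perm_inj.
rewrite -[RHS](card_ord_preim_ltn injh (ltnW (gk i))).
by congr #|pred_of_set _|; apply/finset.setP => j; rewrite !inE ord_g.
Qed.

Lemma one_line_order (k : nat) (tau : 'S_k) (g : nat -> nat) :
  (forall i : 'I_k, g i < k) ->
  (forall i j : 'I_k, (tau i < tau j) = (g i < g j)) ->
  one_line tau = [seq (g i).+1 | i <- iota 0 k].
Proof.
move=> gk ord_g; rewrite -val_enum_ord -map_comp.
by apply: eq_map => i /=; rewrite (@perm_order_eq k tau g gk ord_g).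
Qed.

(** * The words as functions of the position *)

Lemma id_wordE (k : nat) : id_word k = [seq i.+1 | i <- iota 0 k].
Proof. exact: (iotaDl 1 0 k). Qed.

Lemma map_iota_eq (k : nat) (g : nat -> nat) (s : seq nat) :
  size s = k -> (forall i, i < k -> nth 0 s i = g i) -> [seq g i | i <- iota 0 k] = s.
Proof.
move=> szs eqs; apply: (@eq_from_nth _ 0); rewrite size_map size_iota ?szs // => i ltik.
by rewrite (nth_map 0) ?size_iota // nth_iota // eqs.
Qed.

Lemma u_wordE (k : nat) : 1 < k ->
  u_word k = [seq (if i == 0 then k.-1 else if i == k.-1 then 0 else i).+1
             | i <- iota 0 k].
Proof.
move=> k1; rewrite /u_word leqNgt k1 /=; symmetry; apply: map_iota_eq.
  by rewrite /= size_cat size_iota /=; if_lia.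
case=> [|i] ik /=; first by if_lia.
rewrite nth_cat size_iota; case: ltnP => ik2; first by rewrite nth_iota; if_lia.
by rewrite (_ : i - (k - 2) = 0) /=; if_lia.
Qed.

Lemma v_wordE (k : nat) : 0 < k ->
  v_word k = [seq (if i == 0 then k.-1 else i.-1).+1 | i <- iota 0 k].
Proof.
move=> k0; rewrite /v_word; case: leqP => k1; first by have -> : k = 1 by lia.
symmetry; apply: map_iota_eq; first by rewrite /= size_iota; lia.
by case=> [|i] ik /=; [lia | rewrite nth_iota; lia].
Qed.

Lemma w_wordE (k : nat) : 0 < k ->
  w_word k = [seq (if i == k.-1 then 0 else i.+1).+1 | i <- iota 0 k].
Proof.
move=> k0; rewrite /w_word; case: leqP => k1; first by have -> : k = 1 by if_lia.
symmetry; apply: map_iota_eq; first by rewrite size_cat size_iota /=; if_lia.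
move=> i ik; rewrite nth_cat size_iota; case: ltnP => ik2; first by rewrite nth_iota; if_lia.
by rewrite (_ : i - (k - 1) = 0) /=; if_lia.
Qed.

(* The transposition of the letters r and r + 1, letters being counted from 0. *)
Definition swap_adj (r i : nat) : nat :=
  if i == r then r.+1 else if i == r.+1 then r else i.

(** At [k = 1] the function [swap_adj 0] would produce the letter 2, hence the bound on [k]. *)
Lemma x_wordE (k : nat) : 1 < k ->
  x_word k = [seq (swap_adj 0 i).+1 | i <- iota 0 k].
Proof.
move=> k1; rewrite /x_word leqNgt k1 /=; symmetry; apply: map_iota_eq.
  by rewrite /= size_iota; lia.
by case=> [|[|i]] ik //; rewrite /= nth_iota /swap_adj /=; lia.
Qed.

Lemma y_wordE (k : nat) : 1 < k ->
  y_word k = [seq (swap_adj k.-2 i).+1 | i <- iota 0 k].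
Proof.
move=> k1; rewrite /y_word leqNgt k1 /=; symmetry; apply: map_iota_eq.
  by rewrite size_cat size_iota /=; if_lia.
move=> i ik; rewrite nth_cat size_iota /swap_adj; case: ltnP => ik2.
  by rewrite nth_iota; if_lia.
have [->|->] : i = k - 2 \/ i = (k - 2).+1 by if_lia.
  by rewrite subnn /=; if_lia.
by rewrite subSnn /=; if_lia.
Qed.


Lemma val_tperm (n : nat) (a b x : 'I_n) :
  tperm a b x =
    (if x == a :> nat then b : nat else if x == b :> nat then a : nat else x) :> nat.
Proof.
case: tpermP => [-> | -> | /eqP xa /eqP xb]; rewrite ?eqxx //; first by case: eqP.
by rewrite -val_eqE in xa; rewrite -val_eqE in xb; rewrite (negPf xa) (negPf xb).
Qed.

(** * Patterns of the generators *)

Section Patterns.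

Variables (n k : nat) (f : 'I_k -> 'I_n.+2) (tau : 'S_k).
Hypotheses (f_lt : {homo f : i j / i < j}) (k_gt0 : 0 < k).

Let f_mono i j : (f i < f j) = (i < j).
Proof.
case: (ltngtP i j) => [/f_lt | /f_lt | /val_inj ->] /=; last by rewrite ltnn.
  by move=> ->.
by if_lia.
Qed.

Let f_eq i j : (f i == f j :> nat) = (i == j :> nat).
Proof. by have := f_mono i j; have := f_mono j i; if_lia. Qed.

Let last : 'I_k := Ordinal (etrans (f_equal (leq^~ k) (prednK k_gt0)) (leqnn k)).
Let first : 'I_k := Ordinal k_gt0.

Let f_le_last i : f i <= f last.
Proof. by have := f_mono last i; rewrite /=; have := ltn_ord i; if_lia. Qed.

Let f_ge_first i : f first <= f i.
Proof. by have := f_mono i first; rewrite /=; if_lia. Qed.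

(** The map is [a |-> 1 + a] modulo n + 2, increasing except that n + 1 drops to 0. As [f] is
    increasing, only the last position can be sent to n + 1: if it is, the pattern is the cycle,
    otherwise it is increasing. *)
Lemma circular_shift_pattern :
  (forall i j, (perm (GRing.addrI (1 : 'I_n.+2)%R) (f i)
             < perm (GRing.addrI (1 : 'I_n.+2)%R) (f j)) = (tau i < tau j)) ->
  one_line tau \in [:: w_word k; id_word k].
Proof.
move=> ordf.
have shiftE (a : 'I_n.+2) : perm (GRing.addrI (1 : 'I_n.+2)%R) a
    = (if a == n.+1 :> nat then 0 else a.+1) :> nat.
  rewrite permE /= add1n; case: eqP => [-> | ne]; first by rewrite modnn.
  by rewrite modn_small //; have := ltn_ord a; if_lia.
rewrite !inE; apply/orP; case: (eqVneq (f last : nat) n.+1) => e; [left|right].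
  rewrite w_wordE //; apply/eqP.
  apply: one_line_order => [i | i j]; first by have := ltn_ord i; if_lia.
  have lst x : (f x == n.+1 :> nat) = (x == k.-1 :> nat).
    by rewrite -(f_eq x last) e.
  rewrite -ordf !shiftE !lst; have := f_mono i j; if_lia.
rewrite id_wordE; apply/eqP.
apply: one_line_order => [i | i j]; first exact: ltn_ord.
rewrite -ordf !shiftE; have := f_mono i j; have := f_le_last i.
by have := f_le_last j; have := ltn_ord (f last); if_lia.
Qed.

(** Only the last position can reach n + 1 and only the first can reach 0. Reaching both, only n +
    1, only 0, or neither gives [u_word], [w_word], [v_word] and [id_word] respectively. *)
Lemma extremal_tperm_pattern :
  (forall i j, (tperm ord0 ord_max (f i) < tperm ord0 ord_max (f j))
             = (tau i < tau j)) ->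
  one_line tau \in [:: u_word k; v_word k; w_word k; id_word k].
Proof.
move=> ordf.
have tpermE (a : 'I_n.+2) : tperm ord0 ord_max a =
    (if a == 0 :> nat then n.+1 else if a == n.+1 :> nat then 0 else a) :> nat.
  exact: val_tperm.
have lst i : (f i == n.+1 :> nat) = (f last == n.+1 :> nat) && (i == last :> nat).
  by have := f_eq i last; have := f_le_last i; have := ltn_ord (f last); if_lia.
have fst i : (f i == 0 :> nat) = (f first == 0 :> nat) && (i == first :> nat).
  by have := f_eq i first; have := f_ge_first i; if_lia.
have lef i : f i <= n.+1 by rewrite -ltnS.
have ltk i := ltn_ord (i : 'I_k).
rewrite !inE.
case: (eqVneq (f last : nat) n.+1) lst => /= el lst;
  case: (eqVneq (f first : nat) 0) fst => /= ef fst.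
(* A single position cannot be sent to both 0 and n + 1. *)
- have k1 : 1 < k by have := f_mono first last; rewrite el ef /=; if_lia.
  apply/orP; left; rewrite u_wordE //; apply/eqP.
  apply: one_line_order => [i | i j]; first by have := ltn_ord i; if_lia.
  rewrite -ordf !tpermE !lst !fst /=.
  by have := f_mono i j; have := lef i; have := lef j; have := ltk i; have := ltk j;
    have := fst i; have := fst j; have := lst i; have := lst j; if_lia.
- do 2 (apply/orP; right); apply/orP; left; rewrite w_wordE //; apply/eqP.
  apply: one_line_order => [i | i j]; first by have := ltn_ord i; if_lia.
  rewrite -ordf !tpermE !lst !fst /=.
  by have := f_mono i j; have := lef i; have := lef j; have := ltk i; have := ltk j;
    have := fst i; have := fst j; have := lst i; have := lst j; if_lia.
- apply/orP; right; apply/orP; left; rewrite v_wordE //; apply/eqP.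
  apply: one_line_order => [i | i j]; first by have := ltn_ord i; if_lia.
  rewrite -ordf !tpermE !lst !fst /=.
  by have := f_mono i j; have := lef i; have := lef j; have := ltk i; have := ltk j;
    have := fst i; have := fst j; have := lst i; have := lst j; if_lia.
- do 3 (apply/orP; right); rewrite id_wordE //; apply/eqP.
  apply: one_line_order => [i | i j]; first by have := ltn_ord i; if_lia.
  rewrite -ordf !tpermE !lst !fst /=; exact: f_mono.
Qed.

(** No value lies between [a] and [b], so the transposition changes no comparison other than that of
    [a] with [b]. The pattern is increasing unless [f] reaches both. *)
Lemma adj_tperm_pattern (a b : 'I_n.+2) : b = a.+1 :> nat ->
  (forall i j, (tperm a b (f i) < tperm a b (f j)) = (tau i < tau j)) ->
  one_line tau = id_word k \/
  exists i j, [/\ f i = a, f j = b, j = i.+1 :> nat & tau = tperm i j].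
Proof.
move=> ab ordf.
case: (pickP (fun i => f i == a)) => [i /eqP ia | na]; last first.
  left; rewrite id_wordE.
  apply: one_line_order => [i | i j]; first exact: ltn_ord.
  rewrite -ordf -f_mono; have := na i; have := na j; rewrite -!val_eqE.
  rewrite !val_tperm /=; if_lia.
case: (pickP (fun i => f i == b)) => [j /eqP jb | nb]; last first.
  left; rewrite id_wordE.
  apply: one_line_order => [i' | i' j]; first exact: ltn_ord.
  rewrite -ordf -f_mono; have := nb i'; have := nb j; rewrite -!val_eqE.
  rewrite !val_tperm /=; if_lia.
right; exists i, j; have inj_f : injective f.
  by move=> x y /(congr1 val) /eqP; rewrite f_eq => /eqP /val_inj.
split=> //.
  have := f_mono i j; rewrite ia jb ab leqnn => /esym ij; apply/eqP.
  (* A position strictly between [i] and [j] would be sent strictly between [a] and [a.+1]. *)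
  rewrite eqn_leq ij andbT leqNgt; apply/negP => ij1.
  have ltk : i.+1 < k by apply: leq_ltn_trans (ltn_ord j).
  have := f_mono i (Ordinal ltk); have := f_mono (Ordinal ltk) j.
  by rewrite ia jb /= ij1 leqnn; if_lia.
apply/permP => x; apply: val_inj.
apply: (@perm_order_eq k tau (fun y => tperm i j y)) => // x1 x2.
(* An injective [f] carries [tperm i j] to [tperm (f i) (f j)], and [f] preserves comparisons. *)
by rewrite -ordf -ia -jb -!inj_tperm // f_mono.
Qed.

End Patterns.

(** The one-line notation of t_{k,r+2}, since [r] counts letters from 0. *)
Definition adj_word (k r : nat) : seq nat := [seq (swap_adj r x).+1 | x <- iota 0 k].

Lemma one_line_adj_tperm (k : nat) (i j : 'I_k) : j = i.+1 :> nat ->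
  one_line (tperm i j) = adj_word k i.
Proof.
move=> ij; rewrite /one_line /adj_word -val_enum_ord -map_comp.
by apply: eq_map => x /=; rewrite val_tperm /swap_adj -ij.
Qed.

Lemma one_line_adj_transp (k r : nat) (p : perms) : adj_transp k r p ->
  one_line (tagged p) \in [seq adj_word k x | x <- iota 0 k.-1].
Proof.
move=> [i [j [ir jr ->]]] /=.
have ij : j = i.+1 :> nat by have := ltn_ord j; lia.
by rewrite one_line_adj_tperm // map_f // mem_iota; have := ltn_ord j; lia.
Qed.

Lemma contains_circular_shift (n k : nat) (tau : 'S_k) : 0 < k ->
  contains (perm (GRing.addrI (1 : 'I_n.+2)%R)) tau ->
  one_line tau \in [:: w_word k; id_word k].
Proof. by move=> k0 [f [f_lt ordf]]; apply: circular_shift_pattern ordf. Qed.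

Lemma contains_extremal_tperm (n k : nat) (tau : 'S_k) : 0 < k ->
  contains (tperm (ord0 : 'I_n.+2) ord_max) tau ->
  one_line tau \in [:: u_word k; v_word k; w_word k; id_word k].
Proof. by move=> k0 [f [f_lt ordf]]; apply: extremal_tperm_pattern ordf. Qed.

(** The last two clauses serve to recognize x_k and y_k: a position before [i] would need a value
    below [a = 0], and one after [j] a value above [b = n.+1]. *)
Lemma contains_adj_tperm (n k : nat) (a b : 'I_n.+2) (tau : 'S_k) : 0 < k ->
  b = a.+1 :> nat -> contains (tperm a b) tau ->
  one_line tau = id_word k \/
  exists i j : 'I_k,
    [/\ j = i.+1 :> nat, tau = tperm i j, a = 0 :> nat -> i = 0 :> nat
      & b = n.+1 :> nat -> j = k.-1 :> nat].
Proof.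
move=> k0 ab [f [f_lt ordf]].
have [-> | [i [j [fi fj ij ->]]]] := adj_tperm_pattern f_lt k0 ab ordf; first by left.
right; exists i, j; split=> //.
  move=> a0; apply/eqP; rewrite -leqn0 leqNgt; apply/negP => i0.
  by have := f_lt (Ordinal k0) i i0; rewrite fi a0.
move=> bn; apply/eqP; rewrite eqn_leq; have := ltn_ord j => ltj.
have ltk1 : k.-1 < k by lia.
apply/andP; split; first by lia.
rewrite leqNgt; apply/negP => j1.
by have := f_lt j (Ordinal ltk1) j1; rewrite fj bn ltnNge -ltnS ltn_ord.
Qed.

(** * Generating sets inside the avoiders *)

Lemma gen_adj_tperm (n : nat) (G : {group 'S_n.+1}) :
  (forall i j : 'I_n.+1, j = i.+1 :> nat -> tperm i j \in G) ->
  G = [set: 'S_n.+1]%SET :> {set _}.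
Proof.
move=> adjG; apply/eqP; rewrite finset.eqEsubset finset.subsetT /=.
(* The transpositions (0, m) generate the symmetric group; they are reached by induction on m. *)
rewrite -(gen_tperm ord0) gen_subG.
apply/fintype.subsetP => _ /imsetP [[m ltm] _ ->].
elim: m ltm => [|m IHm] ltm.
  by rewrite (_ : Ordinal ltm = ord0) ?tperm1 ?group1 //; apply: val_inj.
have [m0 | m_gt0] := posnP m; first by apply: adjG; rewrite /= m0.
have ltm' : m < n.+1 by apply: ltnW.
(* Conjugating (m, m + 1) by (0, m) gives (0, m + 1). *)
rewrite -(@tpermJ_tperm _ (Ordinal ltm')) -?val_eqE //=; last by lia.
by apply: groupJ; [exact: adjG | rewrite tpermC; exact: IHm].
Qed.

Lemma mem_avoiders (T : set perms) (W : nat -> set perms) (n : nat) (pi : 'S_n) :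
  (T `&` Sym_of_length 0 = set0)%classic ->
  (T `&` \bigcup_(k in [set k : nat | 1 <= k]) W k = set0)%classic ->
  (forall k (tau : 'S_k), 0 < k -> contains pi tau -> W k (Tagged (fun m => 'S_m) tau)) ->
  pi \in avoiders n T.
Proof.
move=> T0 TW patW; rewrite inE; apply/asboolP => -[k tau] Ttau /= tau_in.
pose p : perms := Tagged (fun m => 'S_m) tau.
have [k0 | k_gt0] := posnP k.
  suff : (T `&` Sym_of_length 0)%classic p by rewrite T0.
  by split.
suff : (T `&` \bigcup_(k in [set k : nat | 1 <= k]) W k)%classic p by rewrite TW.
by split=> //; exists k => //; apply: patW.
Qed.

(** The transposition (i, j) and the full cycle generate as soon as j - i is prime to n + 2; here j
    - i is 1 or -1 modulo n + 2. *)
Lemma gen_avoiders_of_tperm_shift (n : nat) (T : set perms) (i j : 'I_n.+2) :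
  j = i.+1 :> nat \/ i = 0 :> nat /\ j = n.+1 :> nat ->
  tperm i j \in avoiders n.+2 T ->
  perm (GRing.addrI (1 : 'I_n.+2)%R) \in avoiders n.+2 T ->
  <<avoiders n.+2 T>>%g = [set: 'S_n.+2]%SET.
Proof.
move=> ij tT cT; apply/eqP; rewrite finset.eqEsubset finset.subsetT /=.
rewrite -(@gen_tpermn_circular_shift n i j).
  by rewrite genS //; apply/fintype.subsetP => s /set2P [] ->.
have -> : (j - i)%R = (if j == i.+1 :> nat then 1 else n.+1) :> nat.
  rewrite /= modnDmr; case: ij => [->|[-> ->]].
    rewrite eqxx (_ : i.+1 + (n.+2 - i) = 1 + n.+2); last by have := ltn_ord i; lia.
    by rewrite modnDr modn_small.
  by rewrite subn0 modnDr modn_small //; case: eqP => // ->.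
case: ifP => _; [exact: coprimen1 | exact: coprimeSn].
Qed.

Lemma gen_avoiders (T : set perms) :
  (T `&` Sym_of_length 0 = set0 ->
      [\/ T `&` \bigcup_(k in [set k : nat | 1 <= k])
            of_one_line [:: u_word k; v_word k; w_word k; id_word k] = set0,
          T `&` \bigcup_(k in [set k : nat | 1 <= k])
            (of_one_line [:: id_word k]
             `|` \bigcup_(r in [set r : nat | 2 <= r <= k]) adj_transp k r)
          = set0,
          T `&` \bigcup_(k in [set k : nat | 1 <= k])
            of_one_line [:: w_word k; id_word k; x_word k] = set0
        | T `&` \bigcup_(k in [set k : nat | 1 <= k])
            of_one_line [:: y_word k; id_word k; w_word k] = set0] ->
      forall n : nat, <<avoiders n T>>%g = [set: 'S_n]%SET)%classic.
Proof.
move=> T0 cases n; have [n1 | ] := leqP n 1.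
  (* For n at most 1 the symmetric group is trivial. *)
  apply/eqP; rewrite finset.eqEsubset finset.subsetT /=.
  apply/fintype.subsetP => s _; suff -> : s = 1%g by exact: group1.
  apply/permP => i; apply: val_inj; rewrite perm1.
  by have := ltn_ord i; have := ltn_ord (s i); rewrite /=; lia.
case: n => [|[|n]] // _.
case: cases => TW.
- apply: (@gen_avoiders_of_tperm_shift n T ord0 ord_max); first by right.
    by apply: mem_avoiders T0 TW _ => k tau k0 /contains_extremal_tperm; apply.
  apply: mem_avoiders T0 TW _ => k tau k0 /contains_circular_shift => /(_ k0).
  by rewrite /of_one_line /= !inE => /orP [] ->; rewrite !orbT.
- apply: (@gen_adj_tperm _ <<avoiders n.+2 T>>%G) => i j ij; apply: mem_gen.
  apply: mem_avoiders T0 TW _ => k tau k0 /(contains_adj_tperm k0 ij) [e|].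
    by left; rewrite /of_one_line /= inE e.
  (* The letters of [adj_transp] are counted from 1, so the ordinal [b] is the letter [b.+1]. *)
  move=> [a [b [ab -> _ _]]]; right; exists b.+1 => /=; last by exists a, b.
  by have := ltn_ord b; lia.
- apply: (@gen_avoiders_of_tperm_shift n T ord0 (lift ord0 ord0)); first by left.
    apply: mem_avoiders T0 TW _ => k tau k0 /(contains_adj_tperm k0) [//|e|].
      by rewrite /of_one_line /= !inE e eqxx orbT.
    (* The transposition moves the value 0, so the pattern swaps its first two letters and is
       x_k. *)
    move=> [a [b [ab -> /(_ erefl) a0 _]]]; have := ltn_ord b => ltb.
    rewrite /of_one_line /= !inE one_line_adj_tperm // a0 x_wordE ?eqxx ?orbT //; lia.
  apply: mem_avoiders T0 TW _ => k tau k0 /contains_circular_shift => /(_ k0).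
  by rewrite /of_one_line /= !inE => /orP [] ->; rewrite ?orbT.
- have ltn : n < n.+2 by [].
  apply: (@gen_avoiders_of_tperm_shift n T (Ordinal ltn) ord_max); first by left.
    apply: mem_avoiders T0 TW _ => k tau k0 /(contains_adj_tperm k0) [//|e|].
      by rewrite /of_one_line /= !inE e eqxx orbT.
    move=> [a [b [ab -> _ /(_ erefl) bk]]]; have := ltn_ord b => ltb.
    rewrite /of_one_line /= !inE one_line_adj_tperm // y_wordE; last by lia.
    (* Symmetrically, [b] is the last position, so the swap starts at [k.-2] and the pattern is
       y_k. *)
    by rewrite (_ : (a : nat) = k.-2) ?eqxx //; lia.
  apply: mem_avoiders T0 TW _ => k tau k0 /contains_circular_shift => /(_ k0).
  by rewrite /of_one_line /= !inE => /orP [] ->; rewrite ?orbT.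
Qed.

(** * Forbidden patterns of a single length *)

Local Open Scope classical_set_scope.

(** A word in [W k] has length [k], so among patterns of length [m] only [W m] can be met. *)
Lemma bigcup_of_one_line0 (T : set perms) (W : nat -> seq (seq nat)) (m : nat)
    (l : seq (seq nat)) :
  T `<=` Sym_of_length m -> (forall k s, s \in W k -> size s = k) ->
  all (mem l) (W m) -> T `&` of_one_line l = set0 ->
  T `&` \bigcup_(k in [set k : nat | 1 <= k]) of_one_line (W k) = set0.
Proof.
move=> Tm szW /allP Wl Tl; rewrite -subset0 => p [Tp [k _ pW]]; rewrite -Tl; split=> //.
suff km : k = m by apply: Wl; rewrite -km.
by rewrite -(szW _ _ pW) /one_line size_map size_enum_ord; apply: Tm.
Qed.

Lemma size_one_line_words (k : nat) (s : seq nat) :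
  s \in [:: id_word k; u_word k; v_word k; w_word k; x_word k; y_word k] -> size s = k.
Proof.
rewrite !inE /id_word /u_word /v_word /w_word /x_word /y_word; case: leqP => k1.
  by do 5?[case/orP]; move=> /eqP ->; rewrite size_iota.
by do 5?[case/orP]; move=> /eqP ->; rewrite /= ?size_cat /= size_iota /=; lia.
Qed.

(** The contrapositive of [gen_avoiders], with the inclusions of the words of length [m] in the four
    lists left as a boolean test. *)
Lemma avoiders_not_gen (m : nat) (T : set perms) (n : nat) (l1 l2 l3 l4 : seq (seq nat)) :
  0 < m -> T `<=` Sym_of_length m -> <<avoiders n T>>%g <> [set: 'S_n]%SET ->
  [&& all (mem l1) [:: u_word m; v_word m; w_word m; id_word m],
      all (mem l2) (id_word m :: [seq adj_word m r | r <- iota 0 m.-1]),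
      all (mem l3) [:: w_word m; id_word m; x_word m]
    & all (mem l4) [:: y_word m; id_word m; w_word m]] ->
  [/\ T `&` of_one_line l1 !=set0, T `&` of_one_line l2 !=set0,
      T `&` of_one_line l3 !=set0 & T `&` of_one_line l4 !=set0].
Proof.
move=> m0 Tm ngen /and4P [W1 W2 W3 W4].
have T0 : T `&` Sym_of_length 0 = set0.
  by rewrite -subset0 => p [/Tm pm p0]; move: m0; rewrite -pm p0.
split; apply/set0P/eqP => Tl; apply: ngen; apply: gen_avoiders T0 _ n.
- apply: Or41; apply: bigcup_of_one_line0 Tm _ W1 Tl => k s sW.
  by apply: size_one_line_words; move: sW; rewrite !inE => /or4P [] ->; rewrite ?orbT.
(* The adjacent transpositions are first replaced by their words, to bring condition (b) into the
   form of a family of word lists. *)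
- apply: Or42; pose W k := id_word k :: [seq adj_word k r | r <- iota 0 k.-1].
  have TW : T `&` \bigcup_(k in [set k : nat | 1 <= k]) of_one_line (W k) = set0.
    apply: bigcup_of_one_line0 Tm _ W2 Tl => k s; rewrite inE.
    by case/orP => [/eqP -> | /mapP [r _ ->]]; rewrite ?size_map size_iota.
  rewrite -subset0 -TW => p [Tp [k k0 pW]]; split=> //; exists k => //.
  rewrite /of_one_line /= inE; case: pW => [| [r _ /one_line_adj_transp ->]].
    by rewrite /of_one_line /= inE => ->.
  by rewrite orbT.
- apply: Or43; apply: bigcup_of_one_line0 Tm _ W3 Tl => k s sW.
  by apply: size_one_line_words; move: sW; rewrite !inE => /or3P [] ->; rewrite ?orbT.
- apply: Or44; apply: bigcup_of_one_line0 Tm _ W4 Tl => k s sW.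
  by apply: size_one_line_words; move: sW; rewrite !inE => /or3P [] ->; rewrite ?orbT.
Qed.

Theorem theorem6p1 (T : set perms) :
  [/\ (* general statement; T contains no pattern of length 0 *)
      T `&` Sym_of_length 0 = set0 ->
      [\/ T `&` \bigcup_(k in [set k : nat | 1 <= k])
            of_one_line [:: u_word k; v_word k; w_word k; id_word k] = set0,
          T `&` \bigcup_(k in [set k : nat | 1 <= k])
            (of_one_line [:: id_word k]
             `|` \bigcup_(r in [set r : nat | 2 <= r <= k]) adj_transp k r)
          = set0,
          T `&` \bigcup_(k in [set k : nat | 1 <= k])
            of_one_line [:: w_word k; id_word k; x_word k] = set0
        | T `&` \bigcup_(k in [set k : nat | 1 <= k])
            of_one_line [:: y_word k; id_word k; w_word k] = set0] ->
      forall n : nat, <<avoiders n T>>%g = [set: 'S_n]%SET,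
      (* (i) *)
      T `<=` Sym_of_length 3 ->
      forall n : nat, <<avoiders n T>>%g <> [set: 'S_n]%SET ->
      [/\ T `&` of_one_line
            [:: [:: 1; 2; 3]; [:: 2; 3; 1]; [:: 3; 1; 2]; [:: 3; 2; 1]] !=set0,
          T `&` of_one_line
            [:: [:: 1; 2; 3]; [:: 1; 3; 2]; [:: 2; 1; 3]] !=set0,
          T `&` of_one_line
            [:: [:: 1; 2; 3]; [:: 2; 1; 3]; [:: 2; 3; 1]] !=set0
        & T `&` of_one_line
            [:: [:: 1; 2; 3]; [:: 1; 3; 2]; [:: 2; 3; 1]] !=set0]
    & (* (ii) *)
      T `<=` Sym_of_length 4 ->
      forall n : nat, <<avoiders n T>>%g <> [set: 'S_n]%SET ->
      [/\ T `&` of_one_line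
            [:: [:: 1; 2; 3; 4]; [:: 2; 3; 4; 1];
                [:: 4; 1; 2; 3]; [:: 4; 2; 3; 1]] !=set0,
          T `&` of_one_line
            [:: [:: 1; 2; 3; 4]; [:: 1; 2; 4; 3];
                [:: 1; 3; 2; 4]; [:: 2; 1; 3; 4]] !=set0,
          T `&` of_one_line
            [:: [:: 1; 2; 3; 4]; [:: 2; 1; 3; 4]; [:: 2; 3; 4; 1]] !=set0
        & T `&` of_one_line
            [:: [:: 1; 2; 3; 4]; [:: 1; 2; 4; 3]; [:: 2; 3; 4; 1]] !=set0]].
Proof.
split; first exact: gen_avoiders.
  (* The words of the given length are computed and found in the four lists. *)
  by move=> Tm n ngen; apply: avoiders_not_gen Tm ngen _.
by move=> Tm n ngen; apply: avoiders_not_gen Tm ngen _.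
Qed.
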